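(* Let $M\subseteq\mathbb{T}$ satisfy the standing hypothesis. The complete core of $\rho^\forall_M$ for set-union is the constant closure $\lambda X.\varnothing$; i.e., the $\sqsubseteq$-least upper closure operator $\eta$ on $\langle\wp(\mathbb{T}),\supseteq\rangle$ with $\rho^\forall_M\sqsubseteq\eta$ and $\eta(X\cup Y)=\eta(\eta(X)\cup\eta(Y))$ for all $X,Y\subseteq\mathbb{T}$ is $\lambda X.\varnothing$.
   Context: $\mathbb{T}$ is the set of traces $\langle i,\sigma\rangle$, $i\in\mathbb{Z}$, $\sigma:\mathbb{Z}\to\mathbb{S}$; $X_{\downarrow s}=\{\langle i,\sigma\rangle\in X\mid\sigma_i=s\}$; $\oplus(X)=\{\langle i,\sigma\rangle\mid\langle i+1,\sigma\rangle\in X\}$, $\ominus(X)=\{\langle i,\sigma\rangle\mid\langle i-1,\sigma\rangle\in X\}$, $\curvearrowleft(X)=\{\langle -i,\lambda k.\sigma_{-k}\rangle\mid\langle i,\sigma\rangle\in X\}$. Standing hypothesis on $M$: (i) $|M_{\downarrow s}|>1$ for all $s$; (ii) $\oplus(M)=M=\ominus(M)$ and $\oplus(\curvearrowleft M)=\curvearrowleft M=\ominus(\curvearrowleft M)$. $\rho^\forall_M(X)=\{\langle i,\sigma\rangle\in M\mid M_{\downarrow\sigma_i}\subseteq X\}$. Upper closure operators on $\langle\wp(\mathbb{T}),\supseteq\rangle$: maps monotone w.r.t. $\subseteq$, idempotent, with $\rho(X)\subseteq X$; $\rho\sqsubseteq\eta$ iff $\rho(X)\supseteq\eta(X)$ for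 all $X$. *)

(* Defs.v *)
From mathcomp Require Import all_boot all_order all_algebra.
From mathcomp Require Import classical_sets.

Set Implicit Arguments.
Unset Strict Implicit.
Unset Printing Implicit Defensive.

Import GRing.Theory.

Local Open Scope ring_scope.
Local Open Scope classical_set_scope.

Definition trace (S : Type) : Type := (int * (int -> S))%type.

Section Traces.
Variable S : Type.
Implicit Types (X M : set (trace S)) (s : S) (t : trace S).

Definition current t : S := t.2 t.1.

Definition restrict_state X s : set (trace S) :=
  [set t | X t /\ current t = s].

Definition shift_next X : set (trace S) := [set t | X (t.1 + 1, t.2)].

Definition shift_prev X : set (trace S) := [set t | X (t.1 - 1, t.2)].

Definition reversal X : set (trace S) :=
  [set ((- t.1, fun k : int => t.2 (- k)) : trace S) | t in X].

Definition card_gt1 X : Prop := exists t u, [/\ X t, X u & t <> u].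

Definition standing_hypothesis M : Prop :=
  [/\ forall s, card_gt1 (restrict_state M s),
      shift_next M = M /\ M = shift_prev M
    & shift_next (reversal M) = reversal M /\
      reversal M = shift_prev (reversal M)].

Definition rho_forall M X : set (trace S) :=
  [set t | M t /\ restrict_state M (current t) `<=` X].

End Traces.

Section Closures.
Variable T : Type.
Implicit Types (rho eta : set T -> set T) (f : set T -> set T -> set T).

(* Upper closure operators on the powerset ordered by superset inclusion:
   the concrete order is reversed, so extensivity reads [rho X `<=` X]. *)
Definition is_uco rho : Prop :=
  [/\ forall X Y, X `<=` Y -> rho X `<=` rho Y,
      forall X, rho (rho X) = rho X
    & forall X, rho X `<=` X].

Definition uco_le rho eta : Prop := forall X, eta X `<=` rho X.

Definition complete_for f eta : Prop :=
  forall X Y, eta (f X Y) = eta (f (eta X) (eta Y)).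

Definition is_complete_core f rho eta : Prop :=
  [/\ is_uco eta, uco_le rho eta, complete_for f eta
    & forall eta', is_uco eta' -> uco_le rho eta' -> complete_for f eta' ->
        uco_le eta eta'].

End Closures.

(* Main.v *)
Require Import Defs.
From mathcomp Require Import all_boot all_order all_algebra.
From mathcomp Require Import classical_sets.

Local Open Scope classical_set_scope.

(** Since every state is the current state of at least two traces of [M], no
    singleton contains some [M_{|s}], so [rho_forall M] sends singletons to the
    empty set, and so does every closure above it. If [eta] is such a closure,
    complete for union, splitting the universe as [t] against its complement
    gives [eta setT = eta (eta (~` [set t]))], which misses [t]. *)

Lemma rho_forall_set1 (S : Type) (M : set (trace S)) (t : trace S) :
  (forall s, card_gt1 (restrict_state M s)) -> rho_forall M [set t] = set0.
Proof.
move=> cardM; rewrite -subset0 => u [_ subt].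
(* Two distinct traces share the current state of [u]; [subt] would make both equal to [t]. *)
have [v [w [Mv Mw]]] := cardM (current u).
by apply; rewrite (subt _ Mv) (subt _ Mw).
Qed.

Lemma complete_setU_eq0 (T : Type) (eta : set T -> set T) :
  is_uco eta -> complete_for (@setU T) eta ->
  (forall t, eta [set t] = set0) -> forall X, eta X = set0.
Proof.
move=> [eta_mono _ eta_sub] eta_setU eta1 X; rewrite -subset0 => t etaXt.
(* Monotonicity moves [t] into [eta setT], so one splitting of [setT] serves every [X]. *)
have := eta_mono _ _ (@subsetT _ X) _ etaXt.
rewrite -(setUv [set t]) eta_setU eta1 set0U.
(* One inclusion per nested [eta] puts [t] in the complement of its own singleton. *)
by move=> /eta_sub /eta_sub; apply.
Qed.

Theorem theorem13 (S : Type) (M : set (trace S))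
    (hM : standing_hypothesis M) :
  is_complete_core (@setU (trace S)) (rho_forall M)
    (fun _ : set (trace S) => set0).
Proof.
have [cardM _ _] := hM; split.
- by split=> [X Y _|X|X] //; apply: sub0set.
- by move=> X; apply: sub0set.
- by [].
move=> eta eta_uco rho_eta eta_setU X.
rewrite (complete_setU_eq0 _ _ eta_uco eta_setU) // => t.
(* Reading [set0] backwards as [rho_forall M [set t]] makes the goal an instance of [rho_eta]. *)
by rewrite -subset0 -(rho_forall_set1 _ _ t cardM); apply: rho_eta.
Qed.
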